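(* Let $X$ be a visual Gromov hyperbolic space. Then for any visual metric on the boundary at infinity $\partial_\infty X$, $$\operatorname{asdim} X\le \operatorname{cdim}\partial_\infty X+1 .$$
   Context: Gromov product: for a base point $o$ of a metric space $X$, $(x|x')_o=\tfrac12(|xo|+|x'o|-|xx'|)$. $X$ is (Gromov) hyperbolic if for some $\delta\ge0$, some base point $o$ and all $x,x',x''\in X$: $(x|x'')_o\ge\min\{(x|x')_o,(x'|x'')_o\}-\delta$ (geodesicity is not assumed). A sequence $(x_i)$ converges to infinity if $(x_i|x_j)_o\to\infty$ as $i,j\to\infty$; two such sequences $(x_i),(x_i')$ are equivalent if $(x_i|x_i')_o\to\infty$; $\partial_\infty X$ is the set of equivalence classes. For $\xi,\xi'\in\partial_\infty X$, $(\xi|\xi')_o=\inf\liminf_i (x_i|x_i')_o$ over representatives, and for $x\in X$, $(x|\xi)_o=\inf\liminf_i(x|x_i)_o$. A metric $d$ on $\partial_\infty X$ is visual if there are $o\in X$, $a>1$, $c_1,c_2>0$ with $c_1a^{-(\xi|\xi')_o}\le d(\xi,\xi')\le c_2a^{-(\xi|\xi')_o}$ for all $\xi,\xi'$. A hyperbolic space $X$ is visual if for some base point $x_0$ there is $D>0$ such that for every $x\in X$ there is $\xi\in\partial_\infty X$ with $|xx_0|\le (x|\xi)_{x_0}+D$. Uniform polyhedron: for an index set $J$ let $\mathbb R^J$ be the space of finitely supported functions $J\to\mathbb R$ with the Euclidean ($\ell^2$) distance, and $\Delta^J=\{x: x_j\ge0,\ \sum x_j=1\}$; a simplicial polyhedron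 with a uniform metric is one isometric to a subcomplex of some $\Delta^J$ (with the restricted distance). Asymptotic dimension: $\operatorname{asdim}X$ is the minimal $n$ such that for every $\lambda>0$ there is a $\lambda$-Lipschitz map $f:X\to P$ into a uniform simplicial polyhedron $P$ of dimension $\le n$ such that the preimages $f^{-1}(\sigma)$ of all simplices $\sigma\subset P$ have uniformly bounded diameter. Capacity dimension: Let $Z$ be a metric space. For a family $\mathcal U$ of subsets and $z\in Z$: $\operatorname{mesh}(\mathcal U,z)=\sup\{\operatorname{diam}U: z\in U\in\mathcal U\}$, $\operatorname{mesh}(\mathcal U)=\sup\{\operatorname{diam}U:U\in\mathcal U\}$. A covering is $(m+1)$-colored if it is a union of $m+1$ subfamilies each consisting of pairwise disjoint sets. For an open covering $\mathcal U$: $L(\mathcal U,z)=\min\{\sup_{U\in\mathcal U}\operatorname{dist}(z,Z\setminus U),\ \operatorname{mesh}(\mathcal U,z)\}$, $L(\mathcal U)=\inf_{z}L(\mathcal U,z)$ (Lebesgue number), and the capacity $\operatorname{cap}(\mathcal U)=L(\mathcal U)/\operatorname{mesh}(\mathcal U)\in[0,1]$, with $\operatorname{cap}(\mathcal U)=1$ if $\operatorname{mesh}(\mathcal U)=0$ or $L(\mathcal U)=\operatorname{mesh}(\mathcal U)=\infty$. For $\tau>0$, $\delta\in(0,1)$, integer $m\ge0$, let $c_\tau(Z,m,\delta)$ be the supremum of $\operatorname{cap}(\mathcal U)$ over open $(m+1)$-colored coverings $\mathcal U$ of $Z$ with $\delta\tau\le\operatorname{mesh}(\mathcal U)\le\tau$;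 $c(Z,m,\delta)=\liminf_{\tau\to0}c_\tau(Z,m,\delta)$; $c(Z,m)=\lim_{\delta\to0}c(Z,m,\delta)$ (monotone limit); $\operatorname{cdim}Z=\inf\{m: c(Z,m)>0\}$. *)

(* Defs.v *)
From Stdlib Require Import Reals List.
From Coquelicot Require Import Coquelicot.
Open Scope R_scope.

Definition is_metric {T : Type} (d : T -> T -> R) : Prop :=
  (forall x y, 0 <= d x y) /\ (forall x y, d x y = 0 <-> x = y) /\
  (forall x y, d x y = d y x) /\ (forall x y z, d x z <= d x y + d y z).

Section Gromov.
Context {X : Type} (d : X -> X -> R).

Definition gp (o x x' : X) : R := (d x o + d x' o - d x x') / 2.

Definition gromov_hyperbolic : Prop :=
  exists delta : R, 0 <= delta /\ exists o : X, forall x x' x'' : X,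
    gp o x x'' >= Rmin (gp o x x') (gp o x' x'') - delta.

(* (x_i) converges to infinity: (x_i|x_j)_o -> oo as i,j -> oo
   (independent of the base point; we require it for every base point). *)
Definition conv_inf (x : nat -> X) : Prop :=
  forall (o : X) (M : R), exists N : nat, forall i j : nat,
    (N <= i)%nat -> (N <= j)%nat -> M <= gp o (x i) (x j).

Definition seq_equiv (x y : nat -> X) : Prop :=
  forall (o : X) (M : R), exists N : nat, forall i : nat,
    (N <= i)%nat -> M <= gp o (x i) (y i).

Definition is_bclass (S : (nat -> X) -> Prop) : Prop :=
  exists x, conv_inf x /\ forall y, S y <-> (conv_inf y /\ seq_equiv x y).

Definition bnd : Type := { S : (nat -> X) -> Prop | is_bclass S }.

Definition bgp (o : X) (xi xi' : bnd) : Rbar :=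
  Rbar_glb (fun r => exists x y, proj1_sig xi x /\ proj1_sig xi' y /\
            r = LimInf_seq (fun i => gp o (x i) (y i))).

Definition pbgp (o : X) (x : X) (xi : bnd) : Rbar :=
  Rbar_glb (fun r => exists y, proj1_sig xi y /\
            r = LimInf_seq (fun i => gp o x (y i))).

Definition apow_neg (a : R) (t : Rbar) : R :=
  match t with Finite r => Rpower a (- r) | _ => 0 end.

Definition visual_metric (dB : bnd -> bnd -> R) : Prop :=
  exists (o : X) (a c1 c2 : R), 1 < a /\ 0 < c1 /\ 0 < c2 /\
    forall xi xi' : bnd,
      c1 * apow_neg a (bgp o xi xi') <= dB xi xi' /\
      dB xi xi' <= c2 * apow_neg a (bgp o xi xi').

Definition visual_space : Prop :=
  exists (x0 : X) (D : R), 0 < D /\ forall x : X, exists xi : bnd,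
    Rbar_le (Finite (d x x0)) (Rbar_plus (pbgp x0 x xi) (Finite D)).
End Gromov.

Definition lsum {J : Type} (f : J -> R) (l : list J) : R :=
  fold_right Rplus 0 (map f l).

(* l^2 distance of finitely supported functions J -> R, written as the sup of
   the finite partial sums over finite families of distinct coordinates *)
Definition l2dist {J : Type} (u v : J -> R) : Rbar :=
  Rbar_lub (fun r => exists l : list J, NoDup l /\
            r = sqrt (lsum (fun j => (u j - v j) ^ 2) l)).

(* the face sigma_S of Delta^J spanned by a finite set S (a duplicate-free list) *)
Definition in_face {J : Type} (S : list J) (u : J -> R) : Prop :=
  (forall j, ~ In j S -> u j = 0) /\ (forall j, 0 <= u j) /\
  lsum u S = 1.

Definition simplicial_complex_dim_le {J : Type} (K : list J -> Prop) (n : nat) : Prop :=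
  (forall S, K S -> NoDup S /\ S <> nil /\ (length S <= Datatypes.S n)%nat) /\
  (forall S T, K S -> NoDup T -> T <> nil -> incl T S -> K T).

Definition in_poly {J : Type} (K : list J -> Prop) (u : J -> R) : Prop :=
  exists S, K S /\ in_face S u.

Definition asdim_le {X : Type} (d : X -> X -> R) (n : nat) : Prop :=
  forall lam : R, 0 < lam ->
  exists (J : Type) (K : list J -> Prop) (f : X -> J -> R),
    simplicial_complex_dim_le K n /\
    (forall x, in_poly K (f x)) /\
    (forall x y, Rbar_le (l2dist (f x) (f y)) (Finite (lam * d x y))) /\
    exists B : R, forall S, K S -> forall x y,
      in_face S (f x) -> in_face S (f y) -> d x y <= B.

Section Capacity.
Context {Z : Type} (d : Z -> Z -> R).

Definition diam (A : Z -> Prop) : Rbar :=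
  Rbar_lub (fun r => r = Finite 0 \/ exists x y, A x /\ A y /\ r = Finite (d x y)).

Definition mesh_at (U : (Z -> Prop) -> Prop) (z : Z) : Rbar :=
  Rbar_lub (fun r => exists A, U A /\ A z /\ r = diam A).

Definition mesh (U : (Z -> Prop) -> Prop) : Rbar :=
  Rbar_lub (fun r => exists A, U A /\ r = diam A).

(* dist(z, Z \ A), = +oo if A = Z *)
Definition dist_compl (z : Z) (A : Z -> Prop) : Rbar :=
  Rbar_glb (fun r => exists w, ~ A w /\ r = Finite (d z w)).

Definition leb_at (U : (Z -> Prop) -> Prop) (z : Z) : Rbar :=
  Rbar_min (Rbar_lub (fun r => exists A, U A /\ r = dist_compl z A)) (mesh_at U z).

Definition lebesgue (U : (Z -> Prop) -> Prop) : Rbar :=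
  Rbar_glb (fun r => exists z, r = leb_at U z).

Definition cap (U : (Z -> Prop) -> Prop) : R :=
  match mesh U, lebesgue U with
  | Finite m, Finite l => if Req_EM_T m 0 then 1 else l / m
  | Finite _, p_infty => 1
  | p_infty, p_infty => 1
  | _, _ => 0
  end.

Definition is_open (A : Z -> Prop) : Prop :=
  forall z, A z -> exists r, 0 < r /\ forall w, d z w < r -> A w.

Definition open_cover (U : (Z -> Prop) -> Prop) : Prop :=
  (forall A, U A -> is_open A) /\ (forall z, exists A, U A /\ A z).

Definition colored (m : nat) (U : (Z -> Prop) -> Prop) : Prop :=
  exists F : nat -> (Z -> Prop) -> Prop,
    (forall A, U A <-> exists i, (i <= m)%nat /\ F i A) /\
    (forall i A B, F i A -> F i B -> A <> B -> forall z, ~ (A z /\ B z)).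

Definition c_tau (tau : R) (m : nat) (delta : R) : R :=
  real (Rbar_lub (fun r => r = Finite 0 \/ exists U,
     open_cover U /\ colored m U /\
     Rbar_le (Finite (delta * tau)) (mesh U) /\ Rbar_le (mesh U) (Finite tau) /\
     r = Finite (cap U))).

Definition c_md (m : nat) (delta : R) : Rbar :=
  Rbar_lub (fun r => exists eps, 0 < eps /\
     r = Rbar_glb (fun s => exists tau, 0 < tau < eps /\ s = Finite (c_tau tau m delta))).

(* lim_{delta -> 0} c(Z,m,delta); the limit is monotone (nonincreasing in delta),
   hence equals the sup over delta in (0,1) *)
Definition c_m (m : nat) : Rbar :=
  Rbar_lub (fun r => exists delta, 0 < delta < 1 /\ r = c_md m delta).

Definition cdim_le (n : nat) : Prop :=
  exists m : nat, (m <= n)%nat /\ Rbar_lt (Finite 0) (c_m m).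
End Capacity.

(* Main.v *)
Require Import Defs.
From Stdlib Require Import Reals List.
From Coquelicot Require Import Coquelicot.
From Stdlib Require Import Lra Lia.
From Stdlib Require Import ClassicalEpsilon IndefiniteDescription FunctionalExtensionality.

(* Each x in X shadows a boundary point xi x, and with h x = d x o the ball of radius
   L about x lies over a ball of radius about a^(L - h x) in the boundary.  Positive
   capacity gives at each scale tau_k = const * a^(- step * k) an (m+1)-coloured
   covering U_k of the boundary by sets of diameter at most tau_k and with Lebesgue
   number kap * tau_k >= tau_(k+1).  Every member of U_(k+1) then lies in a member of
   U_k, which makes the nerves into an inverse system of simplicial maps rho.  At
   heights near the k-th level X is sent to the nerve of U_k by barycentric
   coordinates, formed in X so as to be Lipschitz there; between consecutive levels one
   homotopes linearly inside the nerve of U_k and then crosses the mapping cylinder of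
   rho by moving the masses one colour at a time, so at most m+2 vertices occur at
   once.  The result lands in a telescope of dimension m+1, and its Lipschitz constant
   is of order 1/L, which is as small as desired. *)

(** * Scales and the boundary *)

Lemma Rbar_lub_ub (E : Rbar -> Prop) (x : Rbar) : E x -> Rbar_le x (Rbar_lub E).
Proof. exact (proj1 (proj2_sig (Rbar_ex_lub E)) x). Qed.

Lemma Rbar_lub_least (E : Rbar -> Prop) (b : Rbar) :
  (forall x, E x -> Rbar_le x b) -> Rbar_le (Rbar_lub E) b.
Proof. exact (proj2 (proj2_sig (Rbar_ex_lub E)) b). Qed.

Lemma Rbar_glb_lb (E : Rbar -> Prop) (x : Rbar) : E x -> Rbar_le (Rbar_glb E) x.
Proof. exact (proj1 (proj2_sig (Rbar_ex_glb E)) x). Qed.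

Lemma Rbar_glb_greatest (E : Rbar -> Prop) (b : Rbar) :
  (forall x, E x -> Rbar_le b x) -> Rbar_le b (Rbar_glb E).
Proof. exact (proj2 (proj2_sig (Rbar_ex_glb E)) b). Qed.

Lemma Rbar_lub_lt (E : Rbar -> Prop) (b : Rbar) :
  Rbar_lt b (Rbar_lub E) -> exists x, E x /\ Rbar_lt b x.
Proof.
  intros H; apply NNPP; intros N.
  apply (Rbar_lt_not_le _ _ H), Rbar_lub_least.
  intros x Ex; apply Rbar_not_lt_le; intros Hx; apply N; exists x; auto.
Qed.

Lemma Rbar_lt_dense_0 (x : Rbar) :
  Rbar_lt (Finite 0) x -> exists c : R, 0 < c /\ Rbar_lt (Finite c) x.
Proof.
  destruct x as [x| |]; simpl; intros H.
  - exists (x / 2); lra.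
  - exists 1; split; [lra | exact I].
  - contradiction.
Qed.

Lemma LimInf_seq_lt (u : nat -> R) (r : R) :
  Rbar_lt (Finite r) (LimInf_seq u) ->
  exists N, forall i, (N <= i)%nat -> r < u i.
Proof.
  unfold LimInf_seq; destruct (ex_LimInf_seq u) as [l Hl]; simpl.
  destruct l as [l| |]; simpl in *; intros H.
  - assert (He : 0 < l - r) by lra.
    destruct (Hl (mkposreal _ He)) as [_ [N HN]]; exists N; intros i Hi.
    specialize (HN i Hi); simpl in HN; lra.
  - apply Hl.
  - contradiction.
Qed.

Lemma LimInf_seq_ge (u : nat -> R) (r : R) :
  (exists N, forall i, (N <= i)%nat -> r <= u i) ->
  Rbar_le (Finite r) (LimInf_seq u).
Proof.
  intros H.
  rewrite <- (is_LimInf_seq_unique _ _ (is_LimInf_seq_const r)).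
  apply LimInf_le; destruct H as [N HN]; exists N; exact HN.
Qed.

Lemma Rbar_min_ge_l (c : R) (x y : Rbar) :
  Rbar_le (Finite c) (Rbar_min x y) -> Rbar_le (Finite c) x.
Proof.
  destruct x as [x| |], y as [y| |]; simpl; auto; try contradiction.
  intros H; apply Rle_trans with (1 := H), Rmin_l.
Qed.

(** The lower bound [a] on the mesh excludes the convention that gives capacity 1 to a covering of
    mesh 0, so the capacity is an honest quotient unless the Lebesgue number is infinite. *)
Lemma cap_pos_lebesgue {Z : Type} (d : Z -> Z -> R) (U : (Z -> Prop) -> Prop)
    (c a tau : R) :
  0 < c -> 0 < a ->
  Rbar_le (Finite a) (mesh d U) -> Rbar_le (mesh d U) (Finite tau) ->
  c < cap d U -> Rbar_le (Finite (c * a)) (lebesgue d U).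
Proof.
  intros Hc Ha Hm1 Hm2 Hcap; unfold cap in Hcap.
  destruct (mesh d U) as [M| |]; simpl in *; try contradiction.
  destruct (lebesgue d U) as [l| |]; simpl in *; auto; try lra.
  destruct (Req_EM_T M 0) as [E|E]; [lra|].
  assert (c * M < l).
  { apply Rmult_lt_reg_r with (/ M); [apply Rinv_0_lt_compat; lra|].
    replace (c * M * / M) with c by (field; lra); exact Hcap. }
  assert (c * a <= c * M) by (apply Rmult_le_compat_l; lra); lra.
Qed.

Lemma lebesgue_ball {Z : Type} (d : Z -> Z -> R) (U : (Z -> Prop) -> Prop)
    (l r : R) (z : Z) :
  Rbar_le (Finite l) (lebesgue d U) -> r < l ->
  exists A, U A /\ forall w, d z w <= r -> A w.
Proof.
  intros Hl Hr.
  assert (Hz : Rbar_le (Finite l) (leb_at d U z)).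
  { apply Rbar_le_trans with (1 := Hl), Rbar_glb_lb; exists z; reflexivity. }
  apply Rbar_min_ge_l in Hz.
  assert (Hz' : Rbar_lt (Finite r) (Rbar_lub
     (fun s => exists A, U A /\ s = dist_compl d z A))).
  { apply Rbar_lt_le_trans with (2 := Hz); exact Hr. }
  apply Rbar_lub_lt in Hz' as (s & (A & HA & ->) & Hs).
  exists A; split; auto; intros w Hw; apply NNPP; intros N.
  apply (Rbar_lt_not_le _ _ Hs).
  apply Rbar_le_trans with (Finite (d z w)); [|exact Hw].
  apply Rbar_glb_lb; exists w; auto.
Qed.

Lemma diam_le_mesh {Z : Type} (d : Z -> Z -> R) (U : (Z -> Prop) -> Prop)
    (tau : R) (A : Z -> Prop) (x y : Z) :
  Rbar_le (mesh d U) (Finite tau) -> U A -> A x -> A y -> d x y <= tau.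
Proof.
  intros Hm HA Hx Hy.
  assert (H : Rbar_le (Finite (d x y)) (Finite tau)); [|exact H].
  apply Rbar_le_trans with (2 := Hm).
  apply Rbar_le_trans with (diam d A).
  - apply Rbar_lub_ub; right; exists x, y; auto.
  - apply Rbar_lub_ub; exists A; auto.
Qed.

Definition scale_coverings {Z : Type} (d : Z -> Z -> R) (m : nat) (kap tau : R)
    (F : nat -> (Z -> Prop) -> Prop) : Prop :=
  (forall i A B z, F i A -> F i B -> A z -> B z -> A = B) /\
  (forall i A z w, (i <= m)%nat -> F i A -> A z -> A w -> d z w <= tau) /\
  (forall z, exists i A, (i <= m)%nat /\ F i A /\
     forall w, d z w <= kap * tau -> A w).

(** Unwinding the suprema fixes [delta], [eps] and [c] with [c < c_tau] at every scale below [eps].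
    The mesh being at least [delta * tau], a lower bound on the capacity becomes a Lebesgue number
    proportional to [tau], uniformly in [tau]. *)
Lemma cdim_le_scale_coverings {Z : Type} (d : Z -> Z -> R) (n : nat) :
  cdim_le d n -> exists (m : nat) (kap tau0 : R), (m <= n)%nat /\
    0 < kap /\ 0 < tau0 /\ forall tau, 0 < tau < tau0 ->
    exists F, scale_coverings d m kap tau F.
Proof.
  intros (m & Hmn & H).
  apply Rbar_lub_lt in H as (r1 & (delta & Hdelta & ->) & H).
  apply Rbar_lub_lt in H as (r2 & (eps & Heps & ->) & H).
  apply Rbar_lt_dense_0 in H as (c & Hc & H).
  (* The factor [c / 2] is the capacity reached by some covering, [delta] converts mesh into scale,
     and the last half gives the strict inequality that [lebesgue_ball] asks for. *)
  exists m, (c / 2 * delta / 2), eps.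
  assert (Hcd : 0 < c / 2 * delta) by (apply Rmult_lt_0_compat; lra).
  repeat split; auto; try lra.
  intros tau Htau.
  assert (Hct : c < c_tau d tau m delta).
  { assert (K : Rbar_lt (Finite c) (Finite (c_tau d tau m delta))); [|exact K].
    apply Rbar_lt_le_trans with (1 := H), Rbar_glb_lb; exists tau; auto. }
  unfold c_tau in Hct.
  assert (Hlub : Rbar_lt (Finite (c / 2)) (Rbar_lub (fun r => r = Finite 0 \/ exists U,
     open_cover d U /\ colored m U /\
     Rbar_le (Finite (delta * tau)) (mesh d U) /\ Rbar_le (mesh d U) (Finite tau) /\
     r = Finite (cap d U)))).
  (* [real] sends both infinities to 0, so [c < c_tau] with [c > 0] forces a finite supremum. *)
  { destruct (Rbar_lub _) as [l| |]; simpl in *; auto; lra. }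
  apply Rbar_lub_lt in Hlub as (r & [-> | (U & _ & (F & HF & Hdis) & Hm1 & Hm2 & ->)] & Hr);
    simpl in Hr; [lra|].
  assert (Hdt : 0 < delta * tau) by (apply Rmult_lt_0_compat; lra).
  assert (Hleb := cap_pos_lebesgue d U (c / 2) (delta * tau) tau
            ltac:(lra) Hdt Hm1 Hm2 Hr).
  exists F; repeat split.
  - intros i A B z FA FB Az Bz; apply NNPP; intros N.
    apply (Hdis i A B FA FB N z); auto.
  - intros i A z w Hi FA Az Aw.
    apply (diam_le_mesh d U tau A); auto; apply HF; exists i; auto.
  - intros z.
    assert (Hk : c / 2 * delta / 2 * tau < c / 2 * (delta * tau)).
    { assert (0 < c / 2 * delta * tau) by (apply Rmult_lt_0_compat; lra). lra. }
    destruct (lebesgue_ball d U _ _ z Hleb Hk) as (A & UA & HA).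
    apply HF in UA as (i & Hi & FA); exists i, A; auto.
Qed.

Lemma Rpower_pos (a s : R) : 0 < Rpower a s.
Proof. apply exp_pos. Qed.

Lemma Rpower_neg_small (a eps : R) : 1 < a -> 0 < eps ->
  exists s0, forall s, s0 <= s -> Rpower a (- s) < eps.
Proof.
  intros Ha He.
  assert (Hl : 0 < ln a) by (rewrite <- ln_1; apply ln_increasing; lra).
  exists (1 - ln eps / ln a); intros s Hs.
  rewrite <- (exp_ln eps He); unfold Rpower; apply exp_increasing.
  assert (Hm : (1 - ln eps / ln a) * ln a <= s * ln a)
    by (apply Rmult_le_compat_r; lra).
  replace ((1 - ln eps / ln a) * ln a) with (ln a - ln eps) in Hm by (field; lra).
  lra.
Qed.

(** * Gromov products and shadows on the boundary *)

Section Boundary.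
Context {X : Type} (d : X -> X -> R) (Hd : is_metric d).

Lemma gp_comm (o x y : X) : gp d o x y = gp d o y x.
Proof. destruct Hd as (_ & _ & S & _); unfold gp; rewrite (S x y); lra. Qed.

Lemma gp_ge0 (o x y : X) : 0 <= gp d o x y.
Proof.
  destruct Hd as (_ & _ & S & T); unfold gp.
  assert (H := T x o y); rewrite (S o y) in H; lra.
Qed.

Lemma gp_change_base (o o' x y : X) : gp d o x y - d o o' <= gp d o' x y.
Proof.
  destruct Hd as (_ & _ & S & T); unfold gp.
  assert (H := T x o' o); assert (H' := T y o' o); rewrite (S o' o) in H, H'; lra.
Qed.

(** Moving the base point changes each Gromov product by at most [d o o']; one change on each side
    of the inequality adds [2 * d o o'] to [delta]. *)
Lemma hyperbolic_at (o : X) : gromov_hyperbolic d ->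
  exists delta, 0 <= delta /\ forall x y z,
    Rmin (gp d o x y) (gp d o y z) - delta <= gp d o x z.
Proof.
  intros (delta & Hdelta & o' & H).
  assert (P : 0 <= d o o') by apply Hd.
  exists (delta + 2 * d o o'); split; [lra|]; intros x y z.
  assert (H1 := H x y z).
  assert (Hs : d o' o = d o o') by apply Hd.
  assert (B1 := gp_change_base o' o x z).
  assert (B2 := gp_change_base o o' x y).
  assert (B3 := gp_change_base o o' y z).
  rewrite Hs in B1.
  revert H1; unfold Rmin; repeat destruct Rle_dec; lra.
Qed.

Lemma bnd_inhabited (xi : bnd d) : exists u, proj1_sig xi u.
Proof.
  destruct xi as [S (x & Hx & HS)]; simpl; exists x; apply HS; split; auto.
  intros o M; destruct (Hx o M) as [N HN]; exists N; auto.
Qed.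

Lemma apow_neg_le (a s : R) (t : Rbar) : 1 < a ->
  Rbar_le (Finite s) t -> apow_neg a t <= Rpower a (- s).
Proof.
  intros Ha; destruct t as [t| |]; simpl; intros H.
  - apply Rle_Rpower; lra.
  - left; apply Rpower_pos.
  - contradiction.
Qed.

(** The condition [0 <= t] rules out [m_infty], where [apow_neg] takes the value 0 just as it does
    at [p_infty]. *)
Lemma apow_neg_inv (a s c : R) (t : Rbar) : 1 < a -> 0 < c ->
  Rbar_le (Finite 0) t -> c * apow_neg a t <= Rpower a (- s) ->
  Rbar_le (Finite (s + ln c / ln a)) t.
Proof.
  intros Ha Hc; destruct t as [t| |]; simpl; auto; try contradiction.
  intros _ H.
  assert (Hl : 0 < ln a) by (rewrite <- ln_1; apply ln_increasing; lra).
  apply Rnot_lt_le; intros N; apply (Rle_not_lt _ _ H).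
  rewrite <- (exp_ln c Hc) at 1; unfold Rpower; rewrite <- exp_plus.
  apply exp_increasing.
  assert (Hm : t * ln a < (s + ln c / ln a) * ln a)
    by (apply Rmult_lt_compat_r; lra).
  replace ((s + ln c / ln a) * ln a) with (s * ln a + ln c) in Hm by (field; lra).
  lra.
Qed.

(** Visuality chooses [xi x] so that, for [u] representing it, the product of [x] and [u i] is
    eventually at least [d x o - D - 1]. The first estimate applies hyperbolicity along the chain
    [u i], [x], [y], [v i], the second along [x], [u i], [v i], [y]. *)
Lemma visual_parametrization (dB : bnd d -> bnd d -> R) :
  gromov_hyperbolic d -> visual_space d -> visual_metric d dB ->
  exists (xi : X -> bnd d) (o : X) (a C : R), 1 < a /\ 0 < C /\
    (forall x y, dB (xi x) (xi y) <= C * Rpower a (d x y - d x o)) /\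
    (forall Q, 0 < Q -> exists C', forall x y s,
       dB (xi x) (xi y) <= Q * Rpower a (- s) ->
       Rmin (Rmin (d x o) (d y o)) s - C' <= gp d o x y).
Proof.
  intros Hhyp (o & D & HD & Hvis) (o' & a & c1 & c2 & Ha & Hc1 & Hc2 & HdB).
  destruct (functional_choice _ Hvis) as [xi Hxi].
  destruct (hyperbolic_at o Hhyp) as (delta & Hdelta & Hgp).
  assert (Happ : forall x u, proj1_sig (xi x) u ->
     exists N, forall i, (N <= i)%nat -> d x o - D - 1 <= gp d o x (u i)).
  { intros x u Hu.
    assert (Hl : Rbar_lt (Finite (d x o - D - 1)) (LimInf_seq (fun i => gp d o x (u i)))).
    { apply Rbar_lt_le_trans with (pbgp d o x (xi x)).
      - specialize (Hxi x); destruct (pbgp d o x (xi x)); simpl in *; auto; lra.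
      - apply Rbar_glb_lb; exists u; auto. }
    apply LimInf_seq_lt in Hl as [N HN]; exists N; intros i Hi; left; auto. }
  assert (Po : 0 <= d o o') by apply Hd.
  assert (So : d o' o = d o o') by apply Hd.
  (* The exponent collects the loss [D + 1] of visuality, two uses of hyperbolicity, and the passage
     from the base point [o] of visuality to the base point [o'] of the metric [dB]. *)
  exists xi, o, a, (c2 * Rpower a (D + 1 + 2 * delta + d o o')).
  repeat split; auto.
  - apply Rmult_lt_0_compat; auto; apply Rpower_pos.
  - intros x y.
    apply Rle_trans with (1 := proj2 (HdB _ _)).
    rewrite Rmult_assoc, <- Rpower_plus; apply Rmult_le_compat_l; [lra|].
    replace (D + 1 + 2 * delta + d o o' + (d x y - d x o))
      with (- (d x o - d x y - D - 1 - 2 * delta - d o o')) by lra.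
    apply apow_neg_le; auto.
    apply Rbar_glb_greatest; intros r (u & v & Hu & Hv & ->).
    apply LimInf_seq_ge.
    destruct (Happ x u Hu) as [N1 H1], (Happ y v Hv) as [N2 H2].
    exists (N1 + N2)%nat; intros i Hi.
    specialize (H1 i ltac:(lia)); specialize (H2 i ltac:(lia)).
    assert (A1 := Hgp (u i) x (v i)); assert (A2 := Hgp x y (v i)).
    rewrite (gp_comm o (u i) x) in A1.
    assert (A3 := gp_change_base o o' (u i) (v i)).
    assert (T1 : d x o <= d x y + d y o) by apply Hd.
    assert (P1 : 0 <= d x y) by apply Hd.
    assert (G : d x o - d x y <= gp d o x y) by (unfold gp; lra).
    revert A1 A2; unfold Rmin; repeat destruct Rle_dec; lra.
  - intros Q HQ.
    assert (Hl : 0 < ln a) by (rewrite <- ln_1; apply ln_increasing; lra).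
    (* The logarithm comes from inverting the lower visual bound at distance [Q * Rpower a (- s)];
       nothing here depends on [x], [y] or [s]. *)
    exists (D + 2 + Rabs (ln (c1 / Q) / ln a) + d o o' + 2 * delta); intros x y s Hs.
    assert (HcQ : 0 < c1 / Q) by (apply Rdiv_lt_0_compat; lra).
    assert (Hb : Rbar_le (Finite (s + ln (c1 / Q) / ln a)) (bgp d o' (xi x) (xi y))).
    { apply apow_neg_inv; auto.
      - apply Rbar_glb_greatest; intros r (u & v & _ & _ & ->).
        apply LimInf_seq_ge; exists 0%nat; intros; apply gp_ge0.
      - apply Rmult_le_reg_l with Q; auto.
        replace (Q * (c1 / Q * apow_neg a (bgp d o' (xi x) (xi y))))
          with (c1 * apow_neg a (bgp d o' (xi x) (xi y))) by (field; lra).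
        apply Rle_trans with (1 := proj1 (HdB _ _)); auto. }
    destruct (bnd_inhabited (xi x)) as [u Hu], (bnd_inhabited (xi y)) as [v Hv].
    assert (Hlim : Rbar_lt (Finite (s + ln (c1 / Q) / ln a - 1))
                     (LimInf_seq (fun i => gp d o' (u i) (v i)))).
    { apply Rbar_lt_le_trans with (Finite (s + ln (c1 / Q) / ln a)); [simpl; lra|].
      apply Rbar_le_trans with (1 := Hb), Rbar_glb_lb; exists u, v; auto. }
    apply LimInf_seq_lt in Hlim as [N HN].
    destruct (Happ x u Hu) as [N1 H1], (Happ y v Hv) as [N2 H2].
    set (i := (N + N1 + N2)%nat).
    specialize (HN i ltac:(lia)); specialize (H1 i ltac:(lia)).
    specialize (H2 i ltac:(lia)).
    assert (A1 := Hgp x (u i) y); assert (A2 := Hgp (u i) (v i) y).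
    rewrite (gp_comm o (v i) y) in A2.
    assert (A3 := gp_change_base o' o (u i) (v i)); rewrite So in A3.
    assert (A4 := Rle_abs (- (ln (c1 / Q) / ln a))); rewrite Rabs_Ropp in A4.
    assert (A5 := Rabs_pos (ln (c1 / Q) / ln a)).
    revert A1 A2; unfold Rmin; repeat destruct Rle_dec; lra.
Qed.
End Boundary.

(** * Weights on the vertices of a polyhedron *)

Lemma lsum_cons {J : Type} (f : J -> R) (j : J) (l : list J) :
  lsum f (j :: l) = f j + lsum f l.
Proof. reflexivity. Qed.

Lemma lsum_ext {J : Type} (f g : J -> R) (l : list J) :
  (forall j, In j l -> f j = g j) -> lsum f l = lsum g l.
Proof.
  induction l as [|j l IH]; intros H; [reflexivity|].
  rewrite !lsum_cons, (H j (or_introl eq_refl)), IH; auto.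
  intros k Hk; exact (H k (or_intror Hk)).
Qed.

Lemma lsum_le {J : Type} (f g : J -> R) (l : list J) :
  (forall j, In j l -> f j <= g j) -> lsum f l <= lsum g l.
Proof.
  induction l as [|j l IH]; intros H; [apply Rle_refl|].
  rewrite !lsum_cons; apply Rplus_le_compat; [exact (H j (or_introl eq_refl))|].
  apply IH; intros k Hk; exact (H k (or_intror Hk)).
Qed.

Lemma lsum_const {J : Type} (c : R) (l : list J) :
  lsum (fun _ => c) l = INR (length l) * c.
Proof.
  induction l as [|j l IH]; [simpl; unfold lsum; simpl; lra|].
  rewrite lsum_cons, IH; change (length (j :: l)) with (S (length l)); rewrite S_INR; lra.
Qed.

Lemma lsum_ge0 {J : Type} (f : J -> R) (l : list J) :
  (forall j, In j l -> 0 <= f j) -> 0 <= lsum f l.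
Proof.
  intros H; apply Rle_trans with (lsum (fun _ : J => 0) l); [|apply lsum_le; auto].
  rewrite lsum_const; lra.
Qed.

Lemma lsum_plus {J : Type} (f g : J -> R) (l : list J) :
  lsum (fun j => f j + g j) l = lsum f l + lsum g l.
Proof.
  induction l as [|j l IH]; [unfold lsum; simpl; lra|].
  rewrite !lsum_cons, IH; lra.
Qed.

Lemma lsum_scal {J : Type} (c : R) (f : J -> R) (l : list J) :
  lsum (fun j => c * f j) l = c * lsum f l.
Proof.
  induction l as [|j l IH]; [unfold lsum; simpl; lra|].
  rewrite !lsum_cons, IH; lra.
Qed.

Lemma lsum_exchange {I J : Type} (f : I -> J -> R) (k : list I) (l : list J) :
  lsum (fun j => lsum (fun i => f i j) k) l = lsum (fun i => lsum (f i) l) k.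
Proof.
  induction k as [|i k IH].
  - unfold lsum at 2; simpl; rewrite lsum_const; unfold lsum; simpl; lra.
  - rewrite lsum_cons, <- IH, <- lsum_plus; reflexivity.
Qed.

Lemma lsum_Rabs {J : Type} (f : J -> R) (l : list J) :
  Rabs (lsum f l) <= lsum (fun j => Rabs (f j)) l.
Proof.
  induction l as [|j l IH]; [unfold lsum; simpl; rewrite Rabs_R0; lra|].
  rewrite !lsum_cons; apply Rle_trans with (1 := Rabs_triang _ _); lra.
Qed.

Lemma lsum_ge_term {J : Type} (f : J -> R) (j : J) (l : list J) :
  (forall j, In j l -> 0 <= f j) -> In j l -> f j <= lsum f l.
Proof.
  induction l as [|k l IH]; intros H; [contradiction|].
  rewrite lsum_cons.
  assert (H0 := H k (or_introl eq_refl)).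
  assert (Hl := lsum_ge0 f l (fun j Hj => H j (or_intror Hj))).
  intros [->|Hj]; [lra|].
  specialize (IH (fun j Hj => H j (or_intror Hj)) Hj); lra.
Qed.

Lemma lsum_neq0 {J : Type} (f : J -> R) (l : list J) :
  lsum f l <> 0 -> exists j, In j l /\ f j <> 0.
Proof.
  intros H; apply NNPP; intros N; apply H.
  rewrite (lsum_ext f (fun _ => 0)); [rewrite lsum_const; lra|].
  intros j Hj; apply NNPP; intros Hf; apply N; exists j; auto.
Qed.

(** This allows all Lipschitz estimates to be made in the l^1 norm, where the contributions of the
    colours simply add up. *)
Lemma sqrt_lsum_sqr_le {J : Type} (f : J -> R) (l : list J) :
  sqrt (lsum (fun j => f j ^ 2) l) <= lsum (fun j => Rabs (f j)) l.
Proof.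
  assert (P : 0 <= lsum (fun j => Rabs (f j)) l)
    by (apply lsum_ge0; intros; apply Rabs_pos).
  rewrite <- (sqrt_pow2 (lsum (fun j => Rabs (f j)) l)) by exact P.
  apply sqrt_le_1_alt; clear P.
  induction l as [|j l IH]; [unfold lsum; simpl; lra|].
  rewrite !lsum_cons.
  assert (P : 0 <= lsum (fun j => Rabs (f j)) l)
    by (apply lsum_ge0; intros; apply Rabs_pos).
  assert (Q := Rmult_le_pos _ _ (Rabs_pos (f j)) P).
  rewrite <- (pow2_abs (f j)); nra.
Qed.

Definition eq_dec_classic {J : Type} (x y : J) : {x = y} + {x <> y} :=
  excluded_middle_informative (x = y).

Definition mass {J : Type} (v : J) (w : R) (j : J) : R :=
  if eq_dec_classic v j then w else 0.

Lemma mass_neq0 {J : Type} (v j : J) (w : R) : mass v w j <> 0 -> v = j /\ w <> 0.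
Proof. unfold mass; destruct eq_dec_classic; tauto. Qed.

Lemma mass_0 {J : Type} (v j : J) : mass v 0 j = 0.
Proof. unfold mass; destruct eq_dec_classic; reflexivity. Qed.

Lemma mass_ge0 {J : Type} (v j : J) (w : R) : 0 <= w -> 0 <= mass v w j.
Proof. unfold mass; destruct eq_dec_classic; lra. Qed.

Lemma lsum_mass_out {J : Type} (v : J) (w : R) (l : list J) :
  ~ In v l -> lsum (mass v w) l = 0.
Proof.
  intros H; rewrite (lsum_ext _ (fun _ => 0)); [rewrite lsum_const; lra|].
  intros j Hj; unfold mass; destruct eq_dec_classic; [subst; contradiction|auto].
Qed.

Lemma lsum_mass_in {J : Type} (v : J) (w : R) (l : list J) :
  NoDup l -> In v l -> lsum (mass v w) l = w.
Proof.
  induction l as [|j l IH]; intros ND; [contradiction|].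
  inversion ND as [|? ? Hj NDl]; subst; rewrite lsum_cons; unfold mass at 1.
  destruct eq_dec_classic as [->|N]; intros [E|Hv]; try tauto.
  - rewrite lsum_mass_out by auto; lra.
  - subst; congruence.
  - rewrite IH; auto; lra.
Qed.

Lemma lsum_mass_le {J : Type} (v : J) (w : R) (l : list J) :
  NoDup l -> 0 <= w -> lsum (mass v w) l <= w.
Proof.
  intros ND Hw; destruct (classic (In v l)) as [H|H].
  - rewrite lsum_mass_in by auto; lra.
  - rewrite lsum_mass_out by auto; lra.
Qed.

(* The points of weight w on the spoke v and w' on the spoke v' are at distance at most K
   in the cone over the discrete set J; the second clause is the way through the apex. *)
Definition near_spokes {J : Type} (K : R) (v v' : J) (w w' : R) : Prop :=
  (v = v' /\ Rabs (w - w') <= K) \/ w + w' <= K.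

(** On a common spoke a single coordinate differs; on different spokes the l^1 distance is at most
    the total mass [w + w']. *)
Lemma near_spokes_lsum {J : Type} (K : R) (v v' : J) (w w' : R) (l : list J) :
  NoDup l -> 0 <= w -> 0 <= w' -> near_spokes K v v' w w' ->
  lsum (fun j => Rabs (mass v w j - mass v' w' j)) l <= K.
Proof.
  intros ND Hw Hw' [[-> H]|H].
  - apply Rle_trans with (2 := H).
    apply Rle_trans with (2 := lsum_mass_le v' _ l ND (Rabs_pos _)).
    apply lsum_le; intros j _; unfold mass.
    destruct eq_dec_classic; [lra|]; rewrite Rminus_0_r, Rabs_R0; lra.
  - apply Rle_trans with (2 := H).
    apply Rle_trans with (lsum (fun j => mass v w j + mass v' w' j) l).
    + apply lsum_le; intros j _.
      assert (A := mass_ge0 v j w Hw); assert (B := mass_ge0 v' j w' Hw').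
      apply Rabs_le; lra.
    + rewrite lsum_plus; apply Rplus_le_compat; apply lsum_mass_le; auto.
Qed.

(** On a common spoke this is the product rule for bounded Lipschitz functions; through the apex,
    factors at most 1 only shorten the path. *)
Lemma near_spokes_mult {J : Type} (K L g g' : R) (v v' : J) (w w' : R) :
  0 <= g <= 1 -> 0 <= g' <= 1 -> 0 <= w <= 1 -> 0 <= w' -> 0 <= L ->
  Rabs (g - g') <= L -> near_spokes K v v' w w' ->
  near_spokes (K + L) v v' (g * w) (g' * w').
Proof.
  intros Hg Hg' Hw Hw' HL Hgg [[-> H]|H]; [left|right].
  - split; auto.
    replace (g * w - g' * w') with (g' * (w - w') + w * (g - g')) by ring.
    apply Rle_trans with (1 := Rabs_triang _ _); rewrite !Rabs_mult.
    rewrite (Rabs_pos_eq g'), (Rabs_pos_eq w) by lra.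
    assert (A := Rabs_pos (w - w')); assert (B := Rabs_pos (g - g')); nra.
  - nra.
Qed.

(** A map of vertices induces a 1-Lipschitz map of cones, so pushing forward under [rho] costs
    nothing. *)
Lemma near_spokes_map {I J : Type} (r : I -> J) (K : R) (v v' : I) (w w' : R) :
  near_spokes K v v' w w' -> near_spokes K (r v) (r v') w w'.
Proof. intros [[-> H]|H]; [left|right]; auto. Qed.

Lemma near_spokes_Rabs {J : Type} (K : R) (v v' : J) (w w' : R) :
  0 <= w -> 0 <= w' -> near_spokes K v v' w w' -> Rabs (w - w') <= K.
Proof. intros Hw Hw' [[_ H]|H]; auto; apply Rabs_le; lra. Qed.

(** The complex consists of the nonempty sets of at most [N + 1] vertices that lie in the support of
    some [f x]. *)
Lemma polyhedron_of_weights {X J : Type} (d : X -> X -> R) (lam : R) (N : nat)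
    (f : X -> J -> R) (B : R) :
  is_metric d ->
  (forall x j, 0 <= f x j) ->
  (forall x, exists l, (length l <= S N)%nat /\ forall j, f x j <> 0 -> In j l) ->
  (forall x l, NoDup l -> (forall j, f x j <> 0 -> In j l) -> lsum (f x) l = 1) ->
  (forall x y l, NoDup l ->
     lsum (fun j => Rabs (f x j - f y j)) l <= lam * d x y) ->
  (forall x y j, f x j <> 0 -> f y j <> 0 -> d x y <= B) ->
  exists (J : Type) (K : list J -> Prop) (f : X -> J -> R),
    simplicial_complex_dim_le K N /\
    (forall x, in_poly K (f x)) /\
    (forall x y, Rbar_le (l2dist (f x) (f y)) (Finite (lam * d x y))) /\
    exists B : R, forall S, K S -> forall x y,
      in_face S (f x) -> in_face S (f y) -> d x y <= B.
Proof.
  intros (_ & _ & Hsym & Htri) Hpos Hsupp Hsum Hlip HB.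
  exists J, (fun S => NoDup S /\ S <> nil /\ (length S <= Datatypes.S N)%nat /\
                exists x, forall j, In j S -> f x j <> 0), f.
  repeat split.
  - apply H.
  - apply H.
  - apply H.
  - auto.
  - auto.
  - destruct H as (_ & _ & Hl & _).
    apply Nat.le_trans with (2 := Hl), NoDup_incl_length; auto.
  - destruct H as (_ & _ & _ & x & Hx); exists x; auto.
  - intros x; destruct (Hsupp x) as (l & Hl & Hin).
    set (p := fun j => if eq_dec_classic (f x j) 0 then false else true).
    set (s := nodup eq_dec_classic (filter p l)).
    assert (Hs : forall j, In j s <-> f x j <> 0).
    { intros j; unfold s; rewrite nodup_In, filter_In; unfold p.
      destruct eq_dec_classic; split; intros H; try tauto.
      - destruct H; discriminate.
      - auto. }
    assert (H1 : lsum (f x) s = 1).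
    { apply Hsum; [apply NoDup_nodup | apply Hs]. }
    exists s; repeat split; auto.
    + apply NoDup_nodup.
    + intros E; rewrite E in H1; unfold lsum in H1; simpl in H1; lra.
    + apply Nat.le_trans with (2 := Hl), NoDup_incl_length; [apply NoDup_nodup|].
      intros j Hj; apply Hin, Hs, Hj.
    + exists x; apply Hs.
    + intros j Hj; apply NNPP; intros H; apply Hj, Hs, H.
  - intros x y; apply Rbar_lub_least; intros r (l & ND & ->); simpl.
    apply Rle_trans with (2 := Hlip x y l ND).
    apply (sqrt_lsum_sqr_le (fun j => f x j - f y j)).
  (* A face lies in the support of one [f z]. Any point mapped into the face shares a vertex with
     [z], hence is within [B] of [z]. *)
  - exists (2 * B); intros S (_ & _ & _ & z & Hz).
    assert (Hface : forall x, in_face S (f x) -> d x z <= B).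
    { intros x (_ & _ & H).
      destruct (lsum_neq0 (f x) S) as (j & Hj & Hfj); [lra|].
      apply (HB x z j); auto. }
    intros x y Hx Hy; apply Hface in Hx; apply Hface in Hy.
    assert (H := Htri x z y); rewrite (Hsym z y) in H; lra.
Qed.

(** * The telescope *)

Definition ramp (s : R) : R := Rmin 1 (Rmax 0 s).

Lemma ramp_bounds (s : R) : 0 <= ramp s <= 1.
Proof. unfold ramp, Rmin, Rmax; repeat destruct Rle_dec; lra. Qed.

Lemma ramp_0 (s : R) : s <= 0 -> ramp s = 0.
Proof. unfold ramp, Rmin, Rmax; repeat destruct Rle_dec; lra. Qed.

Lemma ramp_1 (s : R) : 1 <= s -> ramp s = 1.
Proof. unfold ramp, Rmin, Rmax; repeat destruct Rle_dec; lra. Qed.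

Lemma ramp_lipschitz (s t : R) : Rabs (ramp s - ramp t) <= Rabs (s - t).
Proof.
  unfold ramp, Rmin, Rmax, Rabs; repeat destruct Rle_dec; repeat destruct Rcase_abs; lra.
Qed.

Lemma Rinv_Rmax1_bounds (s : R) : 0 <= / Rmax 1 s <= 1.
Proof.
  assert (H := Rmax_l 1 s); split.
  - left; apply Rinv_0_lt_compat; lra.
  - rewrite <- Rinv_1 at 2; apply Rinv_le_contravar; lra.
Qed.

(** The difference of the inverses is the difference of the denominators divided by their product,
    which is at least 1. *)
Lemma Rinv_Rmax1_lipschitz (s t : R) :
  Rabs (/ Rmax 1 s - / Rmax 1 t) <= Rabs (s - t).
Proof.
  assert (Hs := Rmax_l 1 s); assert (Ht := Rmax_l 1 t).
  replace (/ Rmax 1 s - / Rmax 1 t)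
    with (/ Rmax 1 s * / Rmax 1 t * (Rmax 1 t - Rmax 1 s)) by (field; lra).
  rewrite !Rabs_mult.
  assert (Bs := Rinv_Rmax1_bounds s); assert (Bt := Rinv_Rmax1_bounds t).
  rewrite (Rabs_pos_eq (/ Rmax 1 s)), (Rabs_pos_eq (/ Rmax 1 t)) by lra.
  assert (H : Rabs (Rmax 1 t - Rmax 1 s) <= Rabs (s - t)).
  { unfold Rmax, Rabs; repeat destruct Rle_dec; repeat destruct Rcase_abs; lra. }
  assert (P := Rabs_pos (Rmax 1 t - Rmax 1 s)).
  assert (/ Rmax 1 s * / Rmax 1 t <= 1) by nra.
  nra.
Qed.

(** Here [j] is the colour in motion at time [s]: for smaller colours [ramp (s - INR i)] has reached
    1, for larger ones it is still 0. *)
Lemma staircase (m : nat) (s : R) : exists j, (j <= m)%nat /\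
  (forall i, (i < j)%nat -> INR i + 1 <= s) /\
  (forall i, (j < i <= m)%nat -> s <= INR i).
Proof.
  induction m as [|m (j & Hj & H1 & H2)].
  - exists 0%nat; repeat split; intros; lia.
  - destruct (Rle_dec s (INR (S m))) as [H|H].
    + exists j; repeat split; auto; intros i Hi.
      destruct (Nat.eq_dec i (S m)) as [->|N]; auto; apply H2; lia.
    + exists (S m); repeat split; auto; intros i Hi; [|lia].
      assert (INR i <= INR m) by (apply le_INR; lia).
      rewrite S_INR in H; lra.
Qed.

(** * Clipped distance to the complement of a set *)

Section ClippedDistance.
Context {X : Type} (d : X -> X -> R) (Hd : is_metric d) (L : R) (HL : 0 < L).

Definition clipped_dist_values (A : X -> Prop) (x : X) (r : R) : Prop :=
  r = 1 \/ exists y, ~ A y /\ r = d x y / L.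

(* min (1, dist (x, X \ A) / L), with value 1 when A = X *)
Definition clipped_dist (A : X -> Prop) (x : X) : R :=
  real (Glb_Rbar (clipped_dist_values A x)).

Lemma dist_div_ge0 (x y : X) : 0 <= d x y / L.
Proof. apply Rdiv_le_0_compat; [apply Hd | exact HL]. Qed.

Lemma clipped_dist_glb (A : X -> Prop) (x : X) :
  is_glb_Rbar (clipped_dist_values A x) (Finite (clipped_dist A x)).
Proof.
  assert (H := Glb_Rbar_correct (clipped_dist_values A x)).
  assert (B : Rbar_le (Finite 0) (Glb_Rbar (clipped_dist_values A x))).
  { apply H; intros r [->|(y & _ & ->)]; simpl; [lra|apply dist_div_ge0]. }
  assert (B1 := proj1 H 1 (or_introl eq_refl)).
  unfold clipped_dist; destruct (Glb_Rbar _); simpl in *; auto; contradiction.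
Qed.

Lemma clipped_dist_ge (A : X -> Prop) (x : X) (b : R) :
  b <= 1 -> (forall y, ~ A y -> b <= d x y / L) -> b <= clipped_dist A x.
Proof.
  intros H1 H2; apply (proj2 (clipped_dist_glb A x) (Finite b)).
  intros r [->|(y & Hy & ->)]; simpl; auto.
Qed.

Lemma clipped_dist_bounds (A : X -> Prop) (x : X) : 0 <= clipped_dist A x <= 1.
Proof.
  split.
  - apply clipped_dist_ge; [lra | intros; apply dist_div_ge0].
  - apply (proj1 (clipped_dist_glb A x) 1); left; reflexivity.
Qed.

Lemma clipped_dist_le (A : X -> Prop) (x y : X) :
  ~ A y -> clipped_dist A x <= d x y / L.
Proof.
  intros H; apply (proj1 (clipped_dist_glb A x)); right; exists y; auto.
Qed.

Lemma clipped_dist_out (A : X -> Prop) (x : X) : ~ A x -> clipped_dist A x = 0.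
Proof.
  intros H; apply Rle_antisym; [|apply clipped_dist_bounds].
  replace 0 with (d x x / L); [apply clipped_dist_le, H|].
  replace (d x x) with 0 by (symmetry; apply Hd; reflexivity); lra.
Qed.

Lemma clipped_dist_in (A : X -> Prop) (x : X) :
  (forall y, d x y < L -> A y) -> clipped_dist A x = 1.
Proof.
  intros H; apply Rle_antisym; [apply clipped_dist_bounds|].
  apply clipped_dist_ge; [lra|]; intros y Hy.
  apply Rmult_le_reg_r with L; auto; unfold Rdiv.
  rewrite Rmult_assoc, Rinv_l, !Rmult_1_r, Rmult_1_l by lra.
  apply Rnot_lt_le; intros N; apply Hy, H, N.
Qed.

Lemma clipped_dist_lipschitz_1 (A : X -> Prop) (x y : X) :
  clipped_dist A x - d x y / L <= clipped_dist A y.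
Proof.
  assert (B := clipped_dist_bounds A x); assert (P := dist_div_ge0 x y).
  apply clipped_dist_ge; [lra|]; intros z Hz.
  assert (H := clipped_dist_le A x z Hz).
  assert (T : d x z / L <= d x y / L + d y z / L).
  { unfold Rdiv; rewrite <- Rmult_plus_distr_r; apply Rmult_le_compat_r.
    - left; apply Rinv_0_lt_compat, HL.
    - apply Hd. }
  lra.
Qed.

Lemma clipped_dist_lipschitz (A : X -> Prop) (x y : X) :
  Rabs (clipped_dist A x - clipped_dist A y) <= d x y / L.
Proof.
  assert (H1 := clipped_dist_lipschitz_1 A x y).
  assert (H2 := clipped_dist_lipschitz_1 A y x).
  replace (d y x) with (d x y) in H2 by apply Hd.
  apply Rabs_le; lra.
Qed.
End ClippedDistance.

(** * Barycentric coordinates of the levels *)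

Section Telescope.
Context {X W : Type} (d : X -> X -> R) (Hd : is_metric d) (w0 : W).
Context (h : X -> R) (h_lip : forall x y, Rabs (h x - h y) <= d x y).
(* M k i w x: x lies in the set labelled w of colour i in the covering of level k *)
Context (m : nat) (M : nat -> nat -> W -> X -> Prop) (A L : R) (HL : 0 < L).

(** The slab above [T (S k)] consists of [m + 4] layers of thickness [L]: one at rest, one for the
    linear homotopy, one for each of the [m + 1] colours, and one at rest again. *)
Let T (k : nat) : R := A + INR (m + 4) * L * INR k.

Hypothesis disjointness :
  forall k i w w' x, M k i w x -> M k i w' x -> w = w'.
Hypothesis lebesgue_number : forall k x, k = 0%nat \/ T k <= h x ->
  exists i w, (i <= m)%nat /\ forall y, d x y < L -> M k i w y.
Context (up : nat -> nat -> W -> nat * W).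
Hypothesis nesting : forall k i w, (fst (up k i w) <= m)%nat /\
  forall x, M (S k) i w x -> M k (fst (up k i w)) (snd (up k i w)) x.

(** Where no set of colour [i] contains [x] the label is arbitrary, and there [phi k i x]
    vanishes. *)
Definition lab (k i : nat) (x : X) : W := epsilon (inhabits w0) (fun w => M k i w x).

Lemma lab_eq (k i : nat) (w : W) (x : X) : M k i w x -> lab k i x = w.
Proof.
  intros H; apply (disjointness k i) with x; auto.
  unfold lab; apply epsilon_spec; exists w; exact H.
Qed.

Definition phi (k i : nat) (x : X) : R := clipped_dist d L (M k i (lab k i x)) x.
Definition phi_sum (k : nat) (x : X) : R := lsum (fun i => phi k i x) (seq 0 (S m)).
(** The cutoff at 1 keeps the normalisation Lipschitz on all of [X]; where some set of level [k]
    contains the [L]-ball about [x] it changes nothing. *)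
Definition psi (k i : nat) (x : X) : R := / Rmax 1 (phi_sum k x) * phi k i x.
Definition vtx (k i : nat) (x : X) : nat * nat * W := (k, i, lab k i x).

Lemma phi_bounds (k i : nat) (x : X) : 0 <= phi k i x <= 1.
Proof. apply clipped_dist_bounds; auto. Qed.

(** With equal labels one clipped distance is compared at two points. With different labels,
    disjointness puts each point outside the set of the other, so both weights are at most
    [d x y / L]. *)
Lemma phi_near (k i : nat) (x y : X) :
  near_spokes (2 * (d x y / L)) (vtx k i x) (vtx k i y) (phi k i x) (phi k i y).
Proof.
  assert (P := dist_div_ge0 d Hd L HL x y).
  destruct (classic (lab k i x = lab k i y)) as [E|N].
  - left; unfold vtx, phi; rewrite E; split; auto.
    assert (H := clipped_dist_lipschitz d Hd L HL (M k i (lab k i y)) x y); lra.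
  - right.
    assert (H : forall x y, lab k i x <> lab k i y -> phi k i x <= d x y / L).
    { clear x y P N; intros x y N; apply clipped_dist_le; auto.
      intros H; apply N; symmetry; apply lab_eq, H. }
    assert (H1 := H x y N); assert (H2 := H y x (not_eq_sym N)).
    replace (d y x) with (d x y) in H2 by apply Hd; lra.
Qed.

Lemma lsum_seq_const (c : R) : lsum (fun _ : nat => c) (seq 0 (S m)) = (INR m + 1) * c.
Proof. rewrite lsum_const, length_seq, S_INR; reflexivity. Qed.

Lemma phi_sum_lipschitz (k : nat) (x y : X) :
  Rabs (phi_sum k x - phi_sum k y) <= (INR m + 1) * (2 * (d x y / L)).
Proof.
  replace (phi_sum k x - phi_sum k y)
    with (lsum (fun i => phi k i x + -1 * phi k i y) (seq 0 (S m)))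
    by (unfold phi_sum; rewrite lsum_plus, lsum_scal; lra).
  apply Rle_trans with (1 := lsum_Rabs _ _); rewrite <- lsum_seq_const.
  apply lsum_le; intros i _.
  replace (phi k i x + -1 * phi k i y) with (phi k i x - phi k i y) by lra.
  apply (near_spokes_Rabs _ _ _ _ _ (proj1 (phi_bounds k i x))
           (proj1 (phi_bounds k i y)) (phi_near k i x y)).
Qed.

Lemma psi_bounds (k i : nat) (x : X) : 0 <= psi k i x <= 1.
Proof.
  assert (H := phi_bounds k i x); assert (H' := Rinv_Rmax1_bounds (phi_sum k x)).
  unfold psi; nra.
Qed.

Lemma psi_near (k i : nat) (x y : X) :
  near_spokes (2 * (d x y / L) + (INR m + 1) * (2 * (d x y / L)))
    (vtx k i x) (vtx k i y) (psi k i x) (psi k i y).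
Proof.
  assert (P := dist_div_ge0 d Hd L HL x y); assert (Pm := pos_INR m).
  apply near_spokes_mult.
  - apply Rinv_Rmax1_bounds.
  - apply Rinv_Rmax1_bounds.
  - apply phi_bounds.
  - apply phi_bounds.
  - apply Rmult_le_pos; lra.
  - apply Rle_trans with (1 := Rinv_Rmax1_lipschitz _ _), phi_sum_lipschitz.
  - apply phi_near.
Qed.

Lemma psi_neq0 (k i : nat) (x : X) : psi k i x <> 0 -> M k i (lab k i x) x.
Proof.
  intros H; apply NNPP; intros N; apply H; unfold psi, phi.
  rewrite clipped_dist_out; auto; lra.
Qed.

(** A set containing the whole [L]-ball about [x] has clipped distance 1 at [x], so [phi_sum] is at
    least 1 and the normalisation is exact. *)
Lemma psi_sum (k : nat) (x : X) : k = 0%nat \/ T k <= h x ->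
  lsum (fun i => psi k i x) (seq 0 (S m)) = 1.
Proof.
  intros H; destruct (lebesgue_number k x H) as (i & w & Hi & Hw).
  assert (Hx : M k i w x).
  { apply Hw; replace (d x x) with 0 by (symmetry; apply Hd; reflexivity); lra. }
  assert (H1 : phi k i x = 1).
  { unfold phi; rewrite (lab_eq _ _ _ _ Hx); apply clipped_dist_in; auto. }
  assert (HS : 1 <= phi_sum k x).
  { rewrite <- H1; apply (lsum_ge_term (fun i => phi k i x)).
    - intros; apply phi_bounds.
    - apply in_seq; lia. }
  unfold psi; rewrite lsum_scal; fold (phi_sum k x).
  rewrite Rmax_right by lra; field; lra.
Qed.

(** * The map on one slab *)

Definition stage (k : nat) (x : X) : R := (h x - T (S k)) / L.
Definition alpha (k : nat) (x : X) : R := ramp (stage k x - 1).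
Definition beta (k i : nat) (x : X) : R := ramp (stage k x - 2 - INR i).
(** The construction applies [rho] at positive levels only, where [pred] is a true predecessor. *)
Definition rho (v : nat * nat * W) : nat * nat * W :=
  let '(k, i, w) := v in (pred k, fst (up (pred k) i w), snd (up (pred k) i w)).

(* On the slab between the heights T (k+1) and T (k+2): a linear homotopy from the
   barycentric map of level k to the push-forward under [rho] of that of level k+1,
   followed by the mapping cylinder of [rho], crossed one colour after the other. *)
Definition G (k : nat) (x : X) (v : nat * nat * W) : R :=
  lsum (fun i =>
    mass (vtx k i x) ((1 - alpha k x) * psi k i x) v +
    mass (rho (vtx (S k) i x)) ((1 - beta k i x) * (alpha k x * psi (S k) i x)) v +
    mass (vtx (S k) i x) (beta k i x * (alpha k x * psi (S k) i x)) v) (seq 0 (S m)).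

Lemma stage_lipschitz (k : nat) (x y : X) :
  Rabs (stage k x - stage k y) <= d x y / L.
Proof.
  unfold stage.
  replace ((h x - T (S k)) / L - (h y - T (S k)) / L) with ((h x - h y) / L)
    by (field; lra).
  unfold Rdiv; rewrite Rabs_mult, (Rabs_pos_eq (/ L))
    by (left; apply Rinv_0_lt_compat, HL).
  apply Rmult_le_compat_r; [left; apply Rinv_0_lt_compat, HL | apply h_lip].
Qed.

Lemma alpha_lipschitz (k : nat) (x y : X) :
  Rabs (alpha k x - alpha k y) <= d x y / L.
Proof.
  apply Rle_trans with (2 := stage_lipschitz k x y).
  apply Rle_trans with (1 := ramp_lipschitz _ _).
  right; f_equal; lra.
Qed.

Lemma beta_lipschitz (k i : nat) (x y : X) :
  Rabs (beta k i x - beta k i y) <= d x y / L.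
Proof.
  apply Rle_trans with (2 := stage_lipschitz k x y).
  apply Rle_trans with (1 := ramp_lipschitz _ _).
  right; f_equal; lra.
Qed.

Lemma one_minus_lipschitz (s t K : R) :
  Rabs (s - t) <= K -> Rabs ((1 - s) - (1 - t)) <= K.
Proof.
  intros H; replace ((1 - s) - (1 - t)) with (- (s - t)) by lra.
  rewrite Rabs_Ropp; exact H.
Qed.

Lemma G_weights_ge0 (k i : nat) (x : X) :
  0 <= (1 - alpha k x) * psi k i x /\
  0 <= alpha k x * psi (S k) i x <= 1 /\
  0 <= (1 - beta k i x) * (alpha k x * psi (S k) i x) /\
  0 <= beta k i x * (alpha k x * psi (S k) i x).
Proof.
  assert (Ha : 0 <= alpha k x <= 1) by apply ramp_bounds.
  assert (Hb : 0 <= beta k i x <= 1) by apply ramp_bounds.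
  assert (H0 := psi_bounds k i x); assert (H1 := psi_bounds (S k) i x).
  assert (0 <= alpha k x * psi (S k) i x <= 1) by nra.
  repeat split; try apply Rmult_le_pos; lra.
Qed.

Lemma G_ge0 (k : nat) (x : X) v : 0 <= G k x v.
Proof.
  apply lsum_ge0; intros i _; destruct (G_weights_ge0 k i x) as (H1 & _ & H2 & H3).
  repeat apply Rplus_le_le_0_compat; apply mass_ge0; auto.
Qed.

Lemma G_lipschitz (k : nat) (x y : X) l : NoDup l ->
  lsum (fun v => Rabs (G k x v - G k y v)) l
  <= 6 * (INR m + 1) * (INR m + 3) * (d x y / L).
Proof.
  intros ND; set (e := d x y / L).
  assert (P : 0 <= e) by apply (dist_div_ge0 d Hd L HL).
  assert (Pm := pos_INR m).
  set (D := fun i v =>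
    Rabs (mass (vtx k i x) ((1 - alpha k x) * psi k i x) v -
          mass (vtx k i y) ((1 - alpha k y) * psi k i y) v) +
    Rabs (mass (rho (vtx (S k) i x)) ((1 - beta k i x) * (alpha k x * psi (S k) i x)) v -
          mass (rho (vtx (S k) i y)) ((1 - beta k i y) * (alpha k y * psi (S k) i y)) v) +
    Rabs (mass (vtx (S k) i x) (beta k i x * (alpha k x * psi (S k) i x)) v -
          mass (vtx (S k) i y) (beta k i y * (alpha k y * psi (S k) i y)) v)).
  apply Rle_trans with (lsum (fun v => lsum (fun i => D i v) (seq 0 (S m))) l).
  { apply lsum_le; intros v _.
    replace (G k x v - G k y v) with (G k x v + -1 * G k y v) by lra.
    unfold G; rewrite <- lsum_scal, <- lsum_plus.
    apply Rle_trans with (1 := lsum_Rabs _ _), lsum_le; intros i _; unfold D.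
    match goal with |- Rabs (?a + ?b + ?c + -1 * (?a' + ?b' + ?c')) <= _ =>
      replace (a + b + c + -1 * (a' + b' + c')) with ((a - a') + (b - b') + (c - c'))
      by ring end.
    apply Rle_trans with (1 := Rabs_triang _ _).
    apply Rplus_le_compat_r, Rabs_triang. }
  rewrite lsum_exchange.
  (* For each colour [psi_near] contributes [2 * (m + 2) * e] to each of three masses, and the
     factors [alpha] and [beta] add [e] each, five times in all: [6 * m + 17] is below
     [6 * (m + 3)]. *)
  apply Rle_trans with (lsum (fun _ => 6 * (INR m + 3) * e) (seq 0 (S m)));
    [|rewrite lsum_seq_const; right; ring].
  apply lsum_le; intros i _; unfold D; rewrite !lsum_plus.
  destruct (G_weights_ge0 k i x) as (X1 & X0 & X2 & X3).
  destruct (G_weights_ge0 k i y) as (Y1 & Y0 & Y2 & Y3).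
  assert (B0 := psi_bounds k i x); assert (B1 := psi_bounds k i y).
  assert (B2 := psi_bounds (S k) i x); assert (B3 := psi_bounds (S k) i y).
  assert (Ax : 0 <= alpha k x <= 1) by apply ramp_bounds.
  assert (Ay : 0 <= alpha k y <= 1) by apply ramp_bounds.
  assert (Bx : 0 <= beta k i x <= 1) by apply ramp_bounds.
  assert (By : 0 <= beta k i y <= 1) by apply ramp_bounds.
  assert (La := alpha_lipschitz k x y); assert (Lb := beta_lipschitz k i x y).
  assert (N0 := psi_near k i x y); assert (N1 := psi_near (S k) i x y).
  fold e in La, Lb, N0, N1.
  set (K := 2 * e + (INR m + 1) * (2 * e)) in *.
  assert (N2 : near_spokes (K + e) (vtx (S k) i x) (vtx (S k) i y)
    (alpha k x * psi (S k) i x) (alpha k y * psi (S k) i y))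
    by (apply near_spokes_mult; auto; lra).
  assert (E1 := near_spokes_lsum (K + e) (vtx k i x) (vtx k i y)
     ((1 - alpha k x) * psi k i x) ((1 - alpha k y) * psi k i y) l ND X1 Y1
     ltac:(apply near_spokes_mult; try apply one_minus_lipschitz; auto; lra)).
  assert (E2 := near_spokes_lsum (K + e + e) (rho (vtx (S k) i x)) (rho (vtx (S k) i y))
     _ _ l ND X2 Y2
     ltac:(apply near_spokes_map, near_spokes_mult; try apply one_minus_lipschitz; auto; lra)).
  assert (E3 := near_spokes_lsum (K + e + e) (vtx (S k) i x) (vtx (S k) i y)
     _ _ l ND X3 Y3 ltac:(apply near_spokes_mult; auto; lra)).
  unfold K in *; lra.
Qed.

Lemma T_S (k : nat) : T (S k) = T k + INR (m + 4) * L.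
Proof. unfold T; rewrite S_INR; ring. Qed.

Lemma stage_le (k : nat) (x : X) (c : R) : h x <= T (S k) + c * L -> stage k x <= c.
Proof.
  intros H; unfold stage; apply Rmult_le_reg_r with L; auto.
  unfold Rdiv; rewrite Rmult_assoc, Rinv_l by lra; lra.
Qed.

Lemma stage_ge (k : nat) (x : X) (c : R) : T (S k) + c * L <= h x -> c <= stage k x.
Proof.
  intros H; unfold stage; apply Rmult_le_reg_r with L; auto.
  unfold Rdiv; rewrite Rmult_assoc, Rinv_l by lra; lra.
Qed.

Lemma alpha_neq0 (k : nat) (x : X) : alpha k x <> 0 -> T (S k) <= h x.
Proof.
  intros H; apply Rnot_lt_le; intros N; apply H, ramp_0.
  assert (stage k x <= 0) by (apply stage_le; lra); lra.
Qed.

(** In this layer both formulas are the barycentric map of level [S k]: the lower one has moved all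
    its colours, the upper one has not begun its homotopy. *)
Lemma G_glue (k : nat) (x : X) v : T (S (S k)) <= h x <= T (S (S k)) + L ->
  G k x v = G (S k) x v.
Proof.
  intros H.
  assert (H1 : INR (m + 4) <= stage k x).
  { apply stage_ge; rewrite T_S in H; lra. }
  assert (H2 : stage (S k) x <= 1) by (apply stage_le; lra).
  rewrite plus_INR in H1; simpl (INR 4) in H1.
  assert (Pm := pos_INR m).
  assert (A1 : alpha k x = 1) by (apply ramp_1; lra).
  assert (A0 : alpha (S k) x = 0) by (apply ramp_0; lra).
  apply lsum_ext; intros i Hi; apply in_seq in Hi.
  assert (Hm : INR i <= INR m) by (apply le_INR; lia).
  assert (B1 : beta k i x = 1) by (apply ramp_1; lra).
  rewrite A1, A0, B1, !Rmult_0_l, !Rmult_0_r, !Rmult_1_l.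
  replace (1 - 1) with 0 by ring; rewrite !Rmult_0_l, Rminus_0_r, Rmult_1_l, !mass_0; ring.
Qed.

Lemma lsum_mass_support {J : Type} (v : J) (w : R) l : NoDup l ->
  (w <> 0 -> In v l) -> lsum (mass v w) l = w.
Proof.
  intros ND H; destruct (Req_dec w 0) as [->|N].
  - rewrite (lsum_ext _ (fun _ => 0)); [rewrite lsum_const; ring|].
    intros; apply mass_0.
  - apply lsum_mass_in; auto.
Qed.

(** Slab [k] leads from level [k] to level [S k]. Slab 0 has no lower end, since level 0 is
    available at every height. *)
Definition in_slab (k : nat) (x : X) : Prop :=
  (k = 0%nat \/ T (S k) <= h x) /\ h x < T (S (S k)).

Lemma G_weight_sum (k : nat) (x : X) : in_slab k x ->
  lsum (fun i => (1 - alpha k x) * psi k i x + alpha k x * psi (S k) i x)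
    (seq 0 (S m)) = 1.
Proof.
  intros [Hk _]; rewrite lsum_plus, !lsum_scal, psi_sum.
  (* Below [T (S k)] the coordinates of level [S k] need not sum to 1, but there [alpha] is 0. *)
  - destruct (Req_dec (alpha k x) 0) as [->|N]; [ring|].
    rewrite psi_sum; [ring|]; right; apply alpha_neq0, N.
  - destruct Hk as [->|Hk]; [left; reflexivity|right].
    rewrite T_S in Hk; assert (0 <= INR (m + 4) * L); [|lra].
    apply Rmult_le_pos; [apply pos_INR|lra].
Qed.

Lemma G_sum_le (k : nat) (x : X) l : in_slab k x -> NoDup l -> lsum (G k x) l <= 1.
Proof.
  intros Hk ND; rewrite <- (G_weight_sum k x Hk).
  unfold G; rewrite lsum_exchange; apply lsum_le; intros i _.
  destruct (G_weights_ge0 k i x) as (H1 & _ & H2 & H3).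
  rewrite !lsum_plus.
  assert (E1 := lsum_mass_le (vtx k i x) _ l ND H1).
  assert (E2 := lsum_mass_le (rho (vtx (S k) i x)) _ l ND H2).
  assert (E3 := lsum_mass_le (vtx (S k) i x) _ l ND H3).
  lra.
Qed.

Lemma G_sum (k : nat) (x : X) l : in_slab k x -> NoDup l ->
  (forall v, G k x v <> 0 -> In v l) -> lsum (G k x) l = 1.
Proof.
  intros Hk ND Hl; unfold G; rewrite lsum_exchange.
  (* All terms of [G] are nonnegative, so nothing cancels: a vertex carrying one nonzero mass is in
     the support of [G k x], hence in [l]. *)
  assert (Hin : forall i v, In i (seq 0 (S m)) ->
    mass (vtx k i x) ((1 - alpha k x) * psi k i x) v <> 0 \/
    mass (rho (vtx (S k) i x)) ((1 - beta k i x) * (alpha k x * psi (S k) i x)) v <> 0 \/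
    mass (vtx (S k) i x) (beta k i x * (alpha k x * psi (S k) i x)) v <> 0 -> In v l).
  { intros i v Hi Hv; apply Hl; unfold G.
    match goal with |- lsum ?f _ <> 0 =>
      assert (Hs := lsum_ge_term f i (seq 0 (S m))) end.
    lapply Hs; [clear Hs; intros Hs; specialize (Hs Hi)|].
    2: { intros j _.
      destruct (G_weights_ge0 k j x) as (H1 & _ & H2 & H3).
      repeat apply Rplus_le_le_0_compat; apply mass_ge0; auto. }
    destruct (G_weights_ge0 k i x) as (H1 & _ & H2 & H3).
    assert (P1 := mass_ge0 (vtx k i x) v _ H1).
    assert (P2 := mass_ge0 (rho (vtx (S k) i x)) v _ H2).
    assert (P3 := mass_ge0 (vtx (S k) i x) v _ H3).
    cbv beta in Hs; lra. }
  assert (Hself : forall (u : nat * nat * W) w, w <> 0 -> mass u w u <> 0).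
  { intros u w Hw; unfold mass; destruct eq_dec_classic; congruence. }
  rewrite (lsum_ext _ (fun i => (1 - alpha k x) * psi k i x + alpha k x * psi (S k) i x)).
  - apply G_weight_sum; exact Hk.
  - intros i Hi; rewrite !lsum_plus.
    rewrite !lsum_mass_support; auto.
    + ring.
    + intros Hw; apply (Hin i _ Hi); right; right; apply Hself, Hw.
    + intros Hw; apply (Hin i _ Hi); right; left; apply Hself, Hw.
    + intros Hw; apply (Hin i _ Hi); left; apply Hself, Hw.
Qed.

Lemma G_neq0 (k : nat) (x : X) v : G k x v <> 0 -> exists i, (i <= m)%nat /\
  ((alpha k x <> 1 /\ psi k i x <> 0 /\ v = vtx k i x) \/
   (beta k i x <> 1 /\ alpha k x <> 0 /\ psi (S k) i x <> 0 /\ v = rho (vtx (S k) i x)) \/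
   (beta k i x <> 0 /\ alpha k x <> 0 /\ psi (S k) i x <> 0 /\ v = vtx (S k) i x)).
Proof.
  intros H; apply lsum_neq0 in H as (i & Hi & H); apply in_seq in Hi.
  exists i; split; [lia|].
  destruct (Req_dec (mass (vtx k i x) ((1 - alpha k x) * psi k i x) v) 0) as [E1|N].
  - destruct (Req_dec (mass (rho (vtx (S k) i x))
      ((1 - beta k i x) * (alpha k x * psi (S k) i x)) v) 0) as [E2|N].
    + assert (N : mass (vtx (S k) i x) (beta k i x * (alpha k x * psi (S k) i x)) v <> 0)
        by lra.
      apply mass_neq0 in N as [E N]; right; right.
      repeat split; auto; intros Z; apply N; rewrite Z; ring.
    + apply mass_neq0 in N as [E N]; right; left.
      repeat split; auto; intros Z; apply N; rewrite Z; ring.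
  - apply mass_neq0 in N as [E N]; left.
    repeat split; auto; intros Z; apply N; rewrite Z; ring.
Qed.

(** The parent set again contains [x], and disjointness makes it the set singled out by [lab] in its
    colour. Hence the linear homotopy meets no vertices beyond the [vtx k i' x]. *)
Lemma rho_vtx (k i : nat) (x : X) : psi (S k) i x <> 0 ->
  exists i', (i' <= m)%nat /\ M k i' (lab k i' x) x /\ rho (vtx (S k) i x) = vtx k i' x.
Proof.
  intros H; apply psi_neq0 in H.
  destruct (nesting k i (lab (S k) i x)) as [Hm Hn].
  assert (Hx := Hn x H); assert (E := lab_eq _ _ _ _ Hx).
  exists (fst (up k i (lab (S k) i x))); repeat split; auto.
  - rewrite E; exact Hx.
  - unfold vtx, rho; rewrite E; reflexivity.
Qed.

(** While [alpha] differs from 1 every [beta] is 0, and by [rho_vtx] the [m + 1] vertices of level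
    [k] suffice. Once [alpha] is 1, only colours up to [j] occur at level [S k] and only colours
    from [j] on at their images under [rho]: together [(j + 1) + (m + 1 - j) = m + 2]. *)
Lemma G_support (k : nat) (x : X) :
  exists l, (length l <= S (S m))%nat /\ forall v, G k x v <> 0 -> In v l.
Proof.
  destruct (Req_dec (alpha k x) 1) as [A1|A1].
  - destruct (staircase m (stage k x - 2)) as (j & Hj & Hlo & Hhi).
    exists (map (fun i => vtx (S k) i x) (seq 0 (S j)) ++
            map (fun i => rho (vtx (S k) i x)) (seq j (S m - j))).
    split; [rewrite length_app, !length_map, !length_seq; lia|].
    intros v Hv; apply G_neq0 in Hv as (i & Hi & [H|[H|H]]); apply in_or_app.
    + destruct H; contradiction.
    + right; apply in_map_iff; exists i; split; [symmetry; apply H|].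
      apply in_seq; split; [|lia].
      apply Nat.nlt_ge; intros Hlt; apply (proj1 H), ramp_1.
      specialize (Hlo i Hlt); lra.
    + left; apply in_map_iff; exists i; split; [symmetry; apply H|].
      apply in_seq; split; [lia|].
      apply Nat.nle_gt; intros Hlt; apply (proj1 H), ramp_0.
      specialize (Hhi i ltac:(lia)); lra.
  - exists (map (fun i => vtx k i x) (seq 0 (S m))).
    split; [rewrite length_map, length_seq; lia|].
    intros v Hv; apply G_neq0 in Hv as (i & Hi & [H|[H|H]]); apply in_map_iff.
    + exists i; split; [symmetry; apply H | apply in_seq; lia].
    + destruct H as (_ & _ & H & ->).
      apply rho_vtx in H as (i' & Hi' & _ & E).
      exists i'; split; [symmetry; exact E | apply in_seq; lia].
    + exfalso; apply (proj1 H), ramp_0.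
      assert (Hs : stage k x <= 2).
      { apply Rnot_lt_le; intros N; apply A1, ramp_1; lra. }
      assert (Pi := pos_INR i); lra.
Qed.

Lemma T_pos_step : L <= INR (m + 4) * L.
Proof.
  rewrite plus_INR; simpl (INR 4); assert (P := pos_INR m); nra.
Qed.

(** The points seeing a given vertex lie in one set of one level and, for positive levels, in a band
    of two steps of height; this is what bounds the preimages of simplices. *)
Lemma G_vertex (k : nat) (x : X) v : in_slab k x -> G k x v <> 0 ->
  exists k' i w, v = (k', i, w) /\ M k' i w x /\
    (k' = 0%nat \/ T k' <= h x) /\ h x <= T (S (S k')).
Proof.
  intros [Hk Hk2] H.
  assert (Hstep := T_pos_step).
  assert (Hk0 : k = 0%nat \/ T k <= h x).
  { destruct Hk as [->|Hk]; auto; right; rewrite T_S in Hk; lra. }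
  apply G_neq0 in H as (i & Hi & [H|[H|H]]).
  - destruct H as (_ & H & ->); apply psi_neq0 in H.
    exists k, i, (lab k i x); repeat split; auto; lra.
  - destruct H as (_ & _ & H & ->); apply rho_vtx in H as (i' & _ & H & ->).
    exists k, i', (lab k i' x); repeat split; auto; lra.
  - destruct H as (_ & H' & H & ->); apply psi_neq0 in H; apply alpha_neq0 in H'.
    exists (S k), i, (lab (S k) i x); repeat split; auto.
    rewrite T_S; lra.
Qed.

Lemma in_slab_exists (x : X) : exists k, in_slab k x.
Proof.
  assert (Hstep := T_pos_step).
  destruct (INR_archimed (INR (m + 4) * L) (h x - A)) as [n Hn]; [lra|].
  assert (H : h x < T (S (S n))).
  { rewrite !T_S; unfold T; lra. }
  clear Hn; induction n as [|n IH].
  - exists 0%nat; split; auto.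
  - destruct (Rlt_le_dec (h x) (T (S (S n)))) as [Hlt|Hle]; auto.
    exists (S n); split; auto.
Qed.

(** Slabs are at least [L] high, so the two are adjacent and the upper point lies in the resting
    layer where [G_glue] applies. Nearby points can thus be compared through a single [G k]. *)
Lemma in_slab_near (k l : nat) (x y : X) : (k < l)%nat ->
  in_slab k x -> in_slab l y -> d x y <= L -> l = S k /\ G l y = G k y.
Proof.
  intros Hkl [_ Hx] [[Hl|Hy] _] Hd'; [lia|].
  assert (Hstep := T_pos_step).
  assert (Hh := h_lip x y); apply Rabs_le_between in Hh.
  assert (E : l = S k).
  { destruct (Nat.eq_dec l (S k)) as [E|N]; auto; exfalso.
    assert (INR (S (S (S k))) <= INR (S l)) by (apply le_INR; lia).
    assert (T (S (S (S k))) <= T (S l)).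
    { unfold T; apply Rplus_le_compat_l, Rmult_le_compat_l; lra. }
    rewrite (T_S (S (S k))) in H0; lra. }
  split; auto; subst l.
  apply functional_extensionality; intros v.
  symmetry; apply G_glue; split; lra.
Qed.

Lemma telescope (lam B : R) :
  (forall k i w x y, M k i w x -> M k i w y ->
     k = 0%nat \/ T k <= h x -> k = 0%nat \/ T k <= h y ->
     h x <= T (S (S k)) -> h y <= T (S (S k)) -> d x y <= B) ->
  6 * (INR m + 1) * (INR m + 3) <= lam * L ->
  exists (J : Type) (K : list J -> Prop) (f : X -> J -> R),
    simplicial_complex_dim_le K (S m) /\
    (forall x, in_poly K (f x)) /\
    (forall x y, Rbar_le (l2dist (f x) (f y)) (Finite (lam * d x y))) /\
    exists B : R, forall S, K S -> forall x y,
      in_face S (f x) -> in_face S (f y) -> d x y <= B.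
Proof.
  intros HB Hlam.
  destruct (functional_choice _ in_slab_exists) as [kf Hkf].
  assert (Hsum : forall x l, NoDup l -> (forall v, G (kf x) x v <> 0 -> In v l) ->
     lsum (G (kf x) x) l = 1) by (intros; apply G_sum; auto).
  apply polyhedron_of_weights with (f := fun x => G (kf x) x) (B := B); auto.
  - intros; apply G_ge0.
  - intros; apply G_support.
  - intros x y l ND; destruct (Rle_lt_dec (d x y) L) as [Hnear|Hfar].
    + assert (Hk : exists k, G (kf x) x = G k x /\ G (kf y) y = G k y).
      { destruct (Nat.lt_trichotomy (kf x) (kf y)) as [Hlt|[E|Hlt]].
        - exists (kf x); split; auto; apply (in_slab_near _ _ x); auto.
        - exists (kf x); rewrite <- E; auto.
        - exists (kf y); split; auto; apply (in_slab_near _ _ y); auto.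
          replace (d y x) with (d x y) by apply Hd; auto. }
      destruct Hk as (k & -> & ->).
      apply Rle_trans with (1 := G_lipschitz k x y l ND).
      apply Rle_trans with (lam * L * (d x y / L)).
      * apply Rmult_le_compat_r; [apply dist_div_ge0|]; auto.
      * right; field; lra.
    (* Beyond distance [L] the trivial bound 2 on the l^1 distance suffices, because [lam * L] is at
       least 18. *)
    + assert (H2 : forall x, lsum (G (kf x) x) l <= 1).
      { intros z; apply G_sum_le; auto. }
      apply Rle_trans with (lsum (fun v => G (kf x) x v + G (kf y) y v) l).
      * apply lsum_le; intros v _.
        assert (P := G_ge0 (kf x) x v); assert (Q := G_ge0 (kf y) y v).
        apply Rabs_le; lra.
      * rewrite lsum_plus; assert (Hx := H2 x); assert (Hy := H2 y).
        assert (Pm := pos_INR m).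
        assert (2 <= lam * L) by nra.
        assert (lam * L <= lam * d x y); [|lra].
        apply Rmult_le_compat_l; [|lra]; nra.
  - intros x y v Hx Hy.
    destruct (G_vertex _ _ _ (Hkf x) Hx) as (k & i & w & -> & Mx & Kx & Lx).
    destruct (G_vertex _ _ _ (Hkf y) Hy) as (k' & i' & w' & E & My & Ky & Ly).
    injection E as <- <- <-; apply (HB k i w); auto.
Qed.
End Telescope.

(** * The theorem *)

Section LevelSets.
Context {X Z : Type} (xi : X -> Z) (F : nat -> nat -> (Z -> Prop) -> Prop) (m : nat).

(* Level 0 is the trivial covering: it plays the role of the root of the telescope. *)
Definition level_set (k i : nat) (w : Z -> Prop) (x : X) : Prop :=
  match k with
  | O => i = 0%nat /\ w = (fun _ => True)
  | S _ => (i <= m)%nat /\ F k i w /\ w (xi x)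
  end.

Lemma level_set_disjoint (dZ : Z -> Z -> R) (kap : R) (tau : nat -> R) :
  (forall k, scale_coverings dZ m kap (tau k) (F k)) ->
  forall k i w w' x, level_set k i w x -> level_set k i w' x -> w = w'.
Proof.
  intros HF [|k] i w w' x; simpl.
  - intros [_ ->] [_ ->]; reflexivity.
  - intros (_ & H1 & H2) (_ & H3 & H4); apply (proj1 (HF (S k)) i w w' (xi x)); auto.
Qed.

(** A member of level [S k] has diameter at most [tau (S k)], so it lies in the member of level [k]
    that contains the ball of radius [kap * tau k] about one of its points. If no [xi x] lies in it,
    any parent will do. *)
Lemma level_set_nesting (dZ : Z -> Z -> R) (kap : R) (tau : nat -> R) :
  (forall k, scale_coverings dZ m kap (tau k) (F k)) ->
  (forall k, tau (S k) <= kap * tau k) ->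
  exists up : nat -> nat -> (Z -> Prop) -> nat * (Z -> Prop),
    forall k i w, (fst (up k i w) <= m)%nat /\ forall x,
      level_set (S k) i w x -> level_set k (fst (up k i w)) (snd (up k i w)) x.
Proof.
  intros HF Htau.
  assert (H : forall p : nat * nat * (Z -> Prop), exists q : nat * (Z -> Prop),
    (fst q <= m)%nat /\ forall x,
      level_set (S (fst (fst p))) (snd (fst p)) (snd p) x ->
      level_set (fst (fst p)) (fst q) (snd q) x).
  { intros [[k i] w]; simpl fst; simpl snd.
    destruct k as [|k].
    { exists (0%nat, fun _ => True); split; [simpl; lia|]; simpl; auto. }
    destruct (classic (exists x, level_set (S (S k)) i w x)) as [[x0 Hx0]|N].
    - destruct Hx0 as (Hi & Hw & Hx0).
      destruct (proj2 (proj2 (HF (S k))) (xi x0)) as (i' & A & Hi' & HA & Hball).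
      exists (i', A); split; auto; intros x (_ & _ & Hx).
      repeat split; auto; apply Hball.
      apply Rle_trans with (2 := Htau (S k)).
      apply (proj1 (proj2 (HF (S (S k)))) i w); auto.
    - exists (0%nat, fun _ => True); split; [simpl; lia|].
      intros x Hx; exfalso; apply N; exists x; exact Hx. }
  destruct (functional_choice _ H) as [up Hup].
  exists (fun k i w => up (k, i, w)); intros k i w; exact (Hup (k, i, w)).
Qed.
End LevelSets.

Lemma asdim_le_mono {X : Type} (d : X -> X -> R) (m n : nat) :
  (m <= n)%nat -> asdim_le d m -> asdim_le d n.
Proof.
  intros Hmn H lam Hlam; destruct (H lam Hlam) as (J & K & f & [HK1 HK2] & Hf).
  exists J, K, f; split; auto; split; auto.
  intros S HS; destruct (HK1 S HS) as (H1 & H2 & H3); repeat split; auto; lia.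
Qed.

Theorem theorem1p1 (X : Type) (d : X -> X -> R) (dB : bnd d -> bnd d -> R) :
  is_metric d -> gromov_hyperbolic d -> visual_space d ->
  is_metric dB -> visual_metric d dB ->
  forall n : nat, cdim_le dB n -> asdim_le d (S n).
Proof.
  intros Hd Hhyp Hvis HdB HvB n Hcdim.
  destruct (visual_parametrization d Hd dB Hhyp Hvis HvB)
    as (xi & o & a & C & Ha & HC & Hclose & Hfar).
  destruct (cdim_le_scale_coverings dB n Hcdim)
    as (m & kap & tau0 & Hmn & Hkap & Htau0 & Hcov).
  apply asdim_le_mono with (S m); [lia|].
  intros lam Hlam.
  assert (Pm := pos_INR m).
  set (N := 6 * (INR m + 1) * (INR m + 3)).
  destruct (Rpower_neg_small a kap Ha Hkap) as [s0 Hs0].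
  (* The bound [N / lam] yields the Lipschitz constant [lam]; [s0] makes one step shrink the scale
     by a factor below [kap], so that consecutive levels nest. *)
  set (L := Rmax (N / lam) (Rmax s0 1)).
  assert (L1 : N / lam <= L) by apply Rmax_l.
  assert (L2 : s0 <= L).
  { apply Rle_trans with (2 := Rmax_r _ _), Rmax_l. }
  assert (L3 : 1 <= L).
  { apply Rle_trans with (2 := Rmax_r _ _), Rmax_r. }
  set (step := INR (m + 4) * L).
  assert (Hstep : L <= step).
  { unfold step; rewrite plus_INR; simpl (INR 4); nra. }
  assert (Hq : 0 < 2 * C / kap) by (apply Rdiv_lt_0_compat; lra).
  destruct (Rpower_neg_small a (tau0 / (2 * C / kap)) Ha) as [s1 Hs1].
  { apply Rdiv_lt_0_compat; lra. }
  (* Starting at this height keeps every [tau k] below [tau0]. *)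
  set (A := s1 + L).
  set (T := fun k : nat => A + step * INR k).
  (* An [L]-ball about a point of height at least [T k] has its shadow in a ball of radius
     [C * Rpower a (L - T k)], which is half of [kap * tau k]. *)
  set (tau := fun k : nat => 2 * C / kap * Rpower a (L - T k)).
  assert (HT : forall k, A <= T k).
  { intros k; unfold T; assert (0 <= step * INR k); [|lra].
    apply Rmult_le_pos; [lra | apply pos_INR]. }
  assert (Htau : forall k, 0 < tau k < tau0).
  { intros k; split.
    - apply Rmult_lt_0_compat; [lra | apply Rpower_pos].
    - assert (H := Hs1 (T k - L)); specialize (HT k); unfold A in HT.
      replace (- (T k - L)) with (L - T k) in H by lra.
      replace tau0 with (2 * C / kap * (tau0 / (2 * C / kap))) by (field; lra).
      apply Rmult_lt_compat_l; auto; apply H; lra. }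
  assert (Hnest : forall k, tau (S k) <= kap * tau k).
  { intros k; unfold tau.
    replace (L - T (S k)) with (- step + (L - T k))
      by (unfold T; rewrite S_INR; ring).
    rewrite Rpower_plus.
    assert (H := Hs0 step ltac:(lra)); assert (P := Rpower_pos a (L - T k)).
    replace (2 * C / kap * (Rpower a (- step) * Rpower a (L - T k)))
      with (Rpower a (- step) * (2 * C / kap * Rpower a (L - T k))) by ring.
    apply Rmult_le_compat_r; [|lra].
    apply Rmult_le_pos; lra. }
  destruct (functional_choice _ (fun k => Hcov (tau k) (Htau k))) as [F HF].
  destruct (level_set_nesting xi F m dB kap tau HF Hnest) as [up Hup].
  (* With this value of [Q], [tau k] is [Q * Rpower a (- T k)]. *)
  destruct (Hfar (2 * C / kap * Rpower a L)) as [C' HC'].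
  { apply Rmult_lt_0_compat; auto; apply Rpower_pos. }
  (* In [B], the term with [A] serves level 0, where both heights are at most [A + 2 * step]. At a
     positive level [k] the heights lie between [T k] and [T k + 2 * step] and the Gromov product is
     at least [T k - C'], so the distance is at most [4 * step + 2 * C']. *)
  apply (telescope d Hd (fun _ => True) (fun x => d x o)) with
    (M := level_set xi F m) (A := A) (L := L) (up := up)
    (B := 2 * Rabs (A + 2 * step) + 4 * step + 2 * Rabs C').
  - intros x y; destruct Hd as (_ & _ & S & Tr).
    assert (T1 := Tr x y o); assert (T2 := Tr y x o); rewrite (S y x) in T2.
    apply Rabs_le; lra.
  - lra.
  - apply (level_set_disjoint xi F m dB kap tau HF).
  - intros [|k] x Hx.
    { exists 0%nat, (fun _ => True); split; [lia|]; simpl; auto. }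
    destruct Hx as [|Hx]; [discriminate|].
    destruct (proj2 (proj2 (HF (S k))) (xi x)) as (i & w & Hi & Hw & Hball).
    exists i, w; split; auto; intros y Hy; repeat split; auto; apply Hball.
    apply Rle_trans with (1 := Hclose x y).
    apply Rle_trans with (C * Rpower a (L - T (S k))).
    + apply Rmult_le_compat_l; [lra|]; apply Rle_Rpower; [lra|].
      unfold T, step; lra.
    + unfold tau; assert (P := Rpower_pos a (L - T (S k))).
      replace (kap * (2 * C / kap * Rpower a (L - T (S k))))
        with (2 * (C * Rpower a (L - T (S k)))) by (field; lra).
      assert (0 <= C * Rpower a (L - T (S k))); [|lra].
      apply Rmult_le_pos; lra.
  - exact Hup.
  - intros k i w x y Hx Hy Kx Ky Lx Ly.
    fold step in Kx, Ky, Lx, Ly; change (d x o <= T (S (S k))) in Lx.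
    change (d y o <= T (S (S k))) in Ly.
    assert (PC := Rle_abs C'); assert (PC' := Rabs_pos C').
    assert (PA := Rle_abs (A + 2 * step)); assert (PA' := Rabs_pos (A + 2 * step)).
    destruct k as [|k].
    + replace (T 2%nat) with (A + 2 * step) in Lx, Ly by (unfold T; simpl; ring).
      destruct Hd as (_ & _ & S & Tr).
      assert (T1 := Tr x o y); rewrite (S o y) in T1; lra.
    + destruct Kx as [|Kx]; [discriminate|]; destruct Ky as [|Ky]; [discriminate|].
      change (T (S k) <= d x o) in Kx; change (T (S k) <= d y o) in Ky.
      destruct Hx as (Hi & Hw & Hx); destruct Hy as (_ & _ & Hy).
      assert (H := proj1 (proj2 (HF (S k))) i w (xi x) (xi y) Hi Hw Hx Hy).
      unfold tau in H.
      replace (L - T (S k)) with (L + - T (S k)) in H by ring.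
      rewrite Rpower_plus, <- Rmult_assoc in H; apply HC' in H.
      replace (T (S (S (S k)))) with (T (S k) + 2 * step) in Lx, Ly
        by (unfold T; rewrite !(S_INR (S _)); ring).
      revert H; unfold gp, Rmin; repeat destruct Rle_dec; lra.
  - fold N; apply Rmult_le_compat_l with (r := lam) in L1; [|lra].
    replace (lam * (N / lam)) with N in L1 by (field; lra); exact L1.
Qed.
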